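(* Let $a,b\in\mathbb{R}$, $\tau>0$, $T=N\tau$ with $N\in\mathbb{N}$, $N\ge 1$, and let $\varphi\in C^{1}([-\tau,0],\mathbb{R})$. Then the stepwise classical solution of $$\ddot y(t)=a\,y(t)+b\,y(t-\tau),\quad t\in[0,T],\qquad y(t)=\varphi(t),\ \ \dot y(t)=\dot\varphi(t),\quad t\in[-\tau,0],$$ is given for $t\in[0,T]$ by $$y_{0}(t)= C_{\tau}^{a,b}(t)\,\varphi(0)+ S_{\tau}^{a,b}(t)\,\dot{\varphi}(0)+ \int_{-\tau}^{0} S_{\tau}^{a,b}(t-\tau-s)\,b\,\varphi(s)\,ds.$$
   Context: Write $(t)_+:=\max\{0,t\}$ and use the convention $0^0=1$. For $a,b\in\mathbb{R}$ and $\tau>0$, the delayed perturbation functions are defined for $t\ge 0$ by the absolutely convergent series $$C_{\tau}^{a,b}(t):=\sum_{k=0}^{\infty}\sum_{m=k}^{\infty}\binom{m}{k}a^{m-k}b^{k}\frac{(t-k\tau)_{+}^{2m}}{(2m)!},\qquad S_{\tau}^{a,b}(t):=\sum_{k=0}^{\infty}\sum_{m=k}^{\infty}\binom{m}{k}a^{m-k}b^{k}\frac{(t-k\tau)_{+}^{2m+1}}{(2m+1)!},$$ and are extended by zero to negative arguments: $C_{\tau}^{a,b}(\eta)=S_{\tau}^{a,b}(\eta)=0$ for $\eta<0$. A function $y:[-\tau,T]\to\mathbb{R}$ is a stepwise (classical) solution of the problem $\ddot y(t)=a\,y(t)+b\,y(t-\tau)+f(t)$ on $[0,T]$ with history $\varphi$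 (here with $f\equiv 0$) if: (i) $y,\dot y\in C([-\tau,T])$; (ii) for each $k=1,\dots,N$, $\ddot y$ exists and is continuous on $((k-1)\tau,k\tau)$ and admits a continuous extension to $[(k-1)\tau,k\tau]$ (so $\ddot y$ may jump at $t=k\tau$); (iii) the equation holds pointwise for all $t\in((k-1)\tau,k\tau)$, $k=1,\dots,N$; (iv) $y(t)=\varphi(t)$ and $\dot y(t)=\dot\varphi(t)$ for all $t\in[-\tau,0]$ (derivatives of $\varphi$ at the endpoints are one-sided). *)

(* Defs.v *)
From Stdlib Require Import Reals Factorial.
From Coquelicot Require Import Coquelicot.
Open Scope R_scope.

(* Stdlib reals with Coquelicot.  A function on a real interval is a total
   function [R -> R] whose values off the interval are never used. *)

Definition pos_part (t : R) : R := Rmax 0 t.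

(* sum over m >= k of u m *)
Definition Series_from (k : nat) (u : nat -> R) : R :=
  Series (fun j => u (k + j)%nat).

(* [Binomial.C] is the binomial coefficient ([C] alone is Coquelicot's type of
   complex numbers).  The test [t < 0] is needed: since 0 ^ 0 = 1, the term
   k = m = 0 of the series does not vanish for negative t. *)
Definition delay_C (a b tau t : R) : R :=
  if Rlt_dec t 0 then 0 else
  Series (fun k => Series_from k (fun m =>
    Binomial.C m k * a ^ (m - k) * b ^ k
      * (pos_part (t - INR k * tau) ^ (2 * m) / INR (fact (2 * m))))).

Definition delay_S (a b tau t : R) : R :=
  if Rlt_dec t 0 then 0 else
  Series (fun k => Series_from k (fun m =>
    Binomial.C m k * a ^ (m - k) * b ^ k
      * (pos_part (t - INR k * tau) ^ (2 * m + 1) / INR (fact (2 * m + 1))))).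

Definition closed_itv (c d : R) : R -> Prop := fun t => c <= t <= d.
Definition open_itv (c d : R) : R -> Prop := fun t => c < t < d.

(* f is C^1 on [c, d] with derivative df; [D_in] restricts the difference
   quotient to [c, d], so the derivatives at c and d are one-sided. *)
Definition C1_on (c d : R) (f df : R -> R) : Prop :=
  continuous_on (closed_itv c d) f /\
  (forall t, closed_itv c d t -> D_in f df (closed_itv c d) t) /\
  continuous_on (closed_itv c d) df.

(* y solves y'' (t) = a y(t) + b y(t - tau) + f(t) on [0, N tau] with history
   phi, where dphi is the derivative of phi on [- tau, 0].  The values of the
   second derivative ddy at the breakpoints k tau are unconstrained. *)
Definition stepwise_solution (a b tau : R) (N : nat) (f phi dphi y : R -> R)
    : Prop :=
  exists dy ddy : R -> R,
    C1_on (- tau) (INR N * tau) y dy /\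
    (forall k : nat, (1 <= k <= N)%nat ->
       let I := open_itv ((INR k - 1) * tau) (INR k * tau) in
       let J := closed_itv ((INR k - 1) * tau) (INR k * tau) in
       (forall t, I t -> is_derive dy t (ddy t)) /\
       continuous_on I ddy /\
       (exists g : R -> R,
          continuous_on J g /\ forall t, I t -> g t = ddy t) /\
       (forall t, I t -> ddy t = a * y t + b * y (t - tau) + f t)) /\
    (forall t, - tau <= t <= 0 -> y t = phi t /\ dy t = dphi t).

(* Main.v *)
Require Import Defs.
From Stdlib Require Import Reals Factorial Lra Lia.
From Coquelicot Require Import Coquelicot.
Open Scope R_scope.

(** Write [S] and [C] for [delay_S] and [delay_C].  Summing over [m] first, the
    [k]-th layer of each is an entire function [S_layer k] or [C_layer k] of
    [(t - k tau)_+], and at a given time only finitely many layers are nonzero.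
    Differentiating termwise gives [S_layer k' = C_layer k], and Pascal's rule
    gives [C_layer k' = a S_layer k + b S_layer (k - 1)].  Summed over the layers:
    [S' = C] and [C' (t) = a S(t) + b S(t - tau)] for [t > 0], with [S(0) = 0] and
    [C(0) = 1].  So [S] is the fundamental solution of the equation
    ([is_derive_kernel_S], [is_derive_kernel_C]).

    The formula holds for every solution by Green's identity
    ([green_representation]).  For fixed [t], the derivative of
    [S(t - s) y'(s) + C(t - s) y(s)] in [s] is
    [b (S(t - s) y(s - tau) - S(t - tau - s) y(s))], that is
    [W(s - tau) - W(s)] for [W(u) = S(t - tau - u) b y(u)].  Integrate over
    [[0, t]].  The left side gives [y(t) - S(t) y'(0) - C(t) y(0)].  The right
    side is the integral of [W] over [[- tau, 0]] minus its integral over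
    [[t - tau, t]], and the latter is zero because [S] vanishes at negative
    arguments.

    A solution is only piecewise [C^2] and is given on a closed interval.  Both
    difficulties are removed beforehand: a [C^1] function on a closed interval
    extends to a [C^1] function on the line ([C1_on_extension]), and the
    piecewise equation for [y''] is replaced by its integral form
    ([piecewise_derivative_integral]).

    Existence is the method of steps ([method_of_steps]): on each interval of
    length [tau] the delayed term is a known forcing, and the oscillator
    [z'' = a z + h] is solved by variation of constants ([forced_oscillator]). *)

(** * Power series with geometrically bounded weights *)

Definition geom_bounded (w : nat -> R) : Prop :=
  exists r, 1 <= r /\ forall m, Rabs (w m) <= r ^ m.

(** Coefficients of [sum_m w m x^(2m+1) / (2m+1)!] if [odd], and of
    [sum_m w m x^(2m) / (2m)!] otherwise, so that termwise differentiation of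
    power series applies to both. *)
Definition parity_coef (odd : bool) (w : nat -> R) (n : nat) : R :=
  if Bool.eqb (Nat.odd n) odd then w (Nat.div2 n) / INR (fact n) else 0.

Definition even_sum (w : nat -> R) : R -> R := PSeries (parity_coef false w).
Definition odd_sum (w : nat -> R) : R -> R := PSeries (parity_coef true w).

(** The series is dominated by that of [exp (r |x|)] at every [x]. *)
Lemma CV_radius_le_exp (c : nat -> R) (r : R) :
  (forall n, Rabs (c n) <= r ^ n / INR (fact n)) ->
  CV_radius c = p_infty.
Proof.
  intros hc.
  assert (H : forall x, Rbar_le (Rabs x) (CV_radius c)).
  { intros x. apply Rbar_not_lt_le. intros hlt.
    apply (CV_disk_outside c x hlt).
    apply ex_series_lim_0.
    apply (@ex_series_le R_AbsRing R_CompleteNormedModule _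
             (fun n => (r * Rabs x) ^ n / INR (fact n))).
    - intros n.
      change (Rabs (c n * x ^ n) <= (r * Rabs x) ^ n / INR (fact n)).
      rewrite Rabs_mult, <- RPow_abs, Rpow_mult_distr.
      replace (r ^ n * Rabs x ^ n / INR (fact n))
        with (r ^ n / INR (fact n) * Rabs x ^ n)
        by (field; apply INR_fact_neq_0).
      apply Rmult_le_compat_r; [ apply pow_le, Rabs_pos | apply hc ].
    - exists (exp (r * Rabs x)).
      eapply is_series_ext; [ | apply is_exp_Reals ].
      intros n. now rewrite pow_n_pow. }
  destruct (CV_radius c) as [l | | ]; trivial.
  - specialize (H (Rabs l + 1)). simpl in H.
    pose proof (Rle_abs l). pose proof (Rle_abs (Rabs l + 1)). lra.
  - now specialize (H 0).
Qed.

Lemma CV_radius_parity_coef (odd : bool) (w : nat -> R) :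
  geom_bounded w -> CV_radius (parity_coef odd w) = p_infty.
Proof.
  intros (r & hr & hw). apply (CV_radius_le_exp _ r).
  intros n. unfold parity_coef.
  pose proof (INR_fact_lt_0 n).
  destruct (Bool.eqb _ _).
  - unfold Rdiv. rewrite Rabs_mult, (Rabs_pos_eq (/ _)).
    + apply Rmult_le_compat_r; [ left; now apply Rinv_0_lt_compat | ].
      apply Rle_trans with (1 := hw _).
      apply Rle_pow; [ exact hr | apply Nat.div2_decr; lia ].
    + left; now apply Rinv_0_lt_compat.
  - rewrite Rabs_R0. apply Rdiv_le_0_compat; [ apply pow_le; lra | easy ].
Qed.

Lemma fact_S_quotient (x : R) (n : nat) :
  INR (S n) * (x / INR (fact (S n))) = x / INR (fact n).
Proof.
  rewrite fact_simpl, mult_INR. field.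
  split; [ apply INR_fact_neq_0 | now apply not_0_INR ].
Qed.

Lemma is_derive_odd_sum (w : nat -> R) (x : R) :
  geom_bounded w -> is_derive (odd_sum w) x (even_sum w x).
Proof.
  intros hw. unfold odd_sum, even_sum.
  rewrite (PSeries_ext _ (PS_derive (parity_coef true w))).
  - apply is_derive_PSeries. now rewrite CV_radius_parity_coef.
  - intros n. unfold PS_derive, parity_coef.
    destruct (Nat.Even_or_Odd n) as [[m ->] | [m ->]].
    + replace (Nat.odd (2 * m)) with false by (symmetry; apply Nat.odd_even).
      rewrite Nat.odd_succ, Nat.even_even.
      simpl Bool.eqb. cbv iota.
      now rewrite fact_S_quotient, Nat.div2_succ_double, Nat.div2_double.
    + rewrite Nat.odd_odd, Nat.odd_succ, Nat.even_odd.
      simpl Bool.eqb. cbv iota. ring.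
Qed.

(** The constant term is lost, so the weights move down by one place. *)
Lemma is_derive_even_sum (w : nat -> R) (x : R) :
  geom_bounded w ->
  is_derive (even_sum w) x (odd_sum (fun m => w (S m)) x).
Proof.
  intros hw. unfold odd_sum, even_sum.
  rewrite (PSeries_ext _ (PS_derive (parity_coef false w))).
  - apply is_derive_PSeries. now rewrite CV_radius_parity_coef.
  - intros n. unfold PS_derive, parity_coef.
    destruct (Nat.Even_or_Odd n) as [[m ->] | [m ->]].
    + replace (Nat.odd (2 * m)) with false by (symmetry; apply Nat.odd_even).
      rewrite Nat.odd_succ, Nat.even_even.
      simpl Bool.eqb. cbv iota. ring.
    + rewrite Nat.odd_odd, Nat.odd_succ, Nat.even_odd.
      simpl Bool.eqb. cbv iota.
      rewrite fact_S_quotient.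
      replace (S (2 * m + 1)) with (2 * S m)%nat by lia.
      replace (2 * m + 1)%nat with (S (2 * m)) by lia.
      now rewrite Nat.div2_succ_double, Nat.div2_double.
Qed.

Lemma odd_sum_0 (w : nat -> R) : odd_sum w 0 = 0.
Proof. unfold odd_sum. now rewrite PSeries_0. Qed.

Lemma even_sum_0 (w : nat -> R) : even_sum w 0 = w 0%nat.
Proof.
  unfold even_sum. rewrite PSeries_0. unfold parity_coef; simpl. field.
Qed.

Lemma odd_sum_linear (w u v : nat -> R) (c d x : R) :
  geom_bounded u -> geom_bounded v ->
  (forall m, w m = c * u m + d * v m) ->
  odd_sum w x = c * odd_sum u x + d * odd_sum v x.
Proof.
  intros hu hv hw. unfold odd_sum.
  assert (E : forall s, geom_bounded s -> ex_pseries (parity_coef true s) x).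
  { intros s hs. apply CV_radius_inside. now rewrite CV_radius_parity_coef. }
  rewrite <- !PSeries_scal, <- PSeries_plus.
  - apply PSeries_ext. intros n.
    unfold PS_plus, PS_scal, parity_coef, plus, scal; simpl; unfold mult; simpl.
    destruct (Bool.eqb _ _); [ rewrite hw; unfold Rdiv; ring | ring ].
  - apply ex_pseries_scal; [ apply Rmult_comm | auto ].
  - apply ex_pseries_scal; [ apply Rmult_comm | auto ].
Qed.

Lemma ex_pseries_fact_quotient (w : nat -> R) (e : nat -> nat) (x : R) :
  geom_bounded w -> (forall m, (m <= e m)%nat) ->
  ex_pseries (fun m => w m / INR (fact (e m))) x.
Proof.
  intros (r & hr & hw) he. apply CV_radius_inside.
  rewrite (CV_radius_le_exp _ r); [ easy | ].
  intros m. unfold Rdiv.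
  pose proof (INR_fact_lt_0 m).
  assert (INR (fact m) <= INR (fact (e m))) by (apply le_INR, fact_le, he).
  rewrite Rabs_mult, (Rabs_pos_eq (/ _)) by (left; apply Rinv_0_lt_compat; lra).
  apply Rmult_le_compat; [ apply Rabs_pos | | apply hw | ].
  - left; apply Rinv_0_lt_compat; lra.
  - now apply Rinv_le_contravar.
Qed.

Lemma ex_pseries_zero (x : R) : ex_pseries (fun _ : nat => 0) x.
Proof. apply CV_radius_inside. now rewrite CV_radius_const_0. Qed.

Lemma parity_coef_even (odd : bool) (w : nat -> R) (m : nat) :
  parity_coef odd w (2 * m) = if odd then 0 else w m / INR (fact (2 * m)).
Proof.
  unfold parity_coef.
  rewrite Nat.div2_double.
  replace (Nat.odd (2 * m)) with false by (symmetry; apply Nat.odd_even).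
  now destruct odd.
Qed.

Lemma parity_coef_odd (odd : bool) (w : nat -> R) (m : nat) :
  parity_coef odd w (2 * m + 1)
  = if odd then w m / INR (fact (2 * m + 1)) else 0.
Proof.
  unfold parity_coef. rewrite Nat.odd_odd.
  replace (2 * m + 1)%nat with (S (2 * m)) by lia.
  rewrite Nat.div2_succ_double. now destruct odd.
Qed.

Lemma even_sum_Series (w : nat -> R) (x : R) :
  geom_bounded w ->
  even_sum w x = Series (fun m => w m * (x ^ (2 * m) / INR (fact (2 * m)))).
Proof.
  intros hw. unfold even_sum. rewrite PSeries_odd_even.
  - rewrite (PSeries_ext (fun n => parity_coef false w (2 * n + 1)) (fun _ => 0))
      by (intros n; apply parity_coef_odd).
    rewrite PSeries_const_0, Rmult_0_r, Rplus_0_r.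
    apply Series_ext. intros m. rewrite parity_coef_even, <- pow_mult.
    unfold Rdiv; ring.
  - eapply ex_pseries_ext; [ intros n; symmetry; apply parity_coef_even | ].
    apply ex_pseries_fact_quotient; [ exact hw | intros; lia ].
  - eapply ex_pseries_ext; [ intros n; symmetry; apply parity_coef_odd | ].
    apply ex_pseries_zero.
Qed.

Lemma odd_sum_Series (w : nat -> R) (x : R) :
  geom_bounded w ->
  odd_sum w x
  = Series (fun m => w m * (x ^ (2 * m + 1) / INR (fact (2 * m + 1)))).
Proof.
  intros hw. unfold odd_sum. rewrite PSeries_odd_even.
  - rewrite (PSeries_ext (fun n => parity_coef true w (2 * n)) (fun _ => 0))
      by (intros n; apply parity_coef_even).
    rewrite PSeries_const_0, Rplus_0_l.
    unfold PSeries. rewrite <- Series_scal_l.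
    apply Series_ext. intros m.
    rewrite parity_coef_odd, pow_add, <- pow_mult, pow_1.
    unfold Rdiv; ring.
  - eapply ex_pseries_ext; [ intros n; symmetry; apply parity_coef_even | ].
    apply ex_pseries_zero.
  - eapply ex_pseries_ext; [ intros n; symmetry; apply parity_coef_odd | ].
    apply ex_pseries_fact_quotient; [ exact hw | intros; lia ].
Qed.

(** * The delayed kernels as finite sums of entire layers *)

(** The guard is needed because [Binomial.C m k] is not zero for [k > m]: its
    denominator then contains [fact (m - k)] with truncated subtraction. *)
Definition delay_weight (a b : R) (k m : nat) : R :=
  if Nat.leb k m then Binomial.C m k * a ^ (m - k) * b ^ k else 0.

Lemma delay_weight_0 (a b : R) (m : nat) : delay_weight a b 0 m = a ^ m.
Proof.
  unfold delay_weight; simpl. rewrite C_n_0, Nat.sub_0_r. ring.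
Qed.

Lemma delay_weight_pascal (a b : R) (k m : nat) :
  delay_weight a b (S k) (S m)
  = a * delay_weight a b (S k) m + b * delay_weight a b k m.
Proof.
  unfold delay_weight. simpl Nat.leb at 1.
  destruct (Nat.leb_spec k m) as [hkm | hkm].
  - destruct (Nat.leb_spec (S k) m) as [hlt | hge].
    + rewrite <- (pascal m k hlt).
      replace (S m - S k)%nat with (S (m - S k)) by lia.
      replace (m - k)%nat with (S (m - S k)) by lia.
      simpl. ring.
    + replace m with k by lia.
      rewrite !C_n_n, !Nat.sub_diag. simpl. ring.
  - destruct (Nat.leb_spec (S k) m); [ lia | ring ].
Qed.

(** Induction with Pascal's rule; the binomial theorem would give the bound
    [(|a| + |b|)^m], and the extra [1] only makes the ratio at least [1]. *)
Lemma geom_bounded_delay_weight (a b : R) (k : nat) :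
  geom_bounded (delay_weight a b k).
Proof.
  pose proof (Rabs_pos a) as ha. pose proof (Rabs_pos b) as hb.
  exists (1 + Rabs a + Rabs b). split; [ lra | ].
  intros m. revert k. induction m as [ | m IH]; intros k.
  - destruct k.
    + rewrite delay_weight_0. simpl. rewrite Rabs_R1. lra.
    + unfold delay_weight; simpl. rewrite Rabs_R0. lra.
  - assert (hr : 0 <= (1 + Rabs a + Rabs b) ^ m) by (apply pow_le; lra).
    assert (H : forall x k', Rabs (x * delay_weight a b k' m)
                             <= Rabs x * (1 + Rabs a + Rabs b) ^ m).
    { intros x k'. rewrite Rabs_mult.
      apply Rmult_le_compat_l; [ apply Rabs_pos | apply IH ]. }
    simpl. destruct k.
    + replace (delay_weight a b 0 (S m)) with (a * delay_weight a b 0 m)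
        by now rewrite !delay_weight_0.
      specialize (H a 0%nat). nra.
    + rewrite delay_weight_pascal.
      pose proof (H a (S k)). pose proof (H b k).
      eapply Rle_trans; [ apply Rabs_triang | nra ].
Qed.

Definition C_layer (a b : R) (k : nat) : R -> R :=
  even_sum (delay_weight a b k).
Definition S_layer (a b : R) (k : nat) : R -> R :=
  odd_sum (delay_weight a b k).

Lemma is_derive_S_layer (a b : R) (k : nat) (x : R) :
  is_derive (S_layer a b k) x (C_layer a b k x).
Proof. apply is_derive_odd_sum, geom_bounded_delay_weight. Qed.

Lemma is_derive_C_layer_0 (a b x : R) :
  is_derive (C_layer a b 0) x (a * S_layer a b 0 x).
Proof.
  unfold S_layer.
  replace (a * odd_sum (delay_weight a b 0) x)
    with (odd_sum (fun m => delay_weight a b 0 (S m)) x).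
  - apply is_derive_even_sum, geom_bounded_delay_weight.
  - rewrite (odd_sum_linear _ (delay_weight a b 0) (delay_weight a b 0) a 0);
      try apply geom_bounded_delay_weight; [ ring | ].
    intros m. rewrite !delay_weight_0. simpl. ring.
Qed.

Lemma is_derive_C_layer_S (a b : R) (k : nat) (x : R) :
  is_derive (C_layer a b (S k)) x (a * S_layer a b (S k) x + b * S_layer a b k x).
Proof.
  unfold S_layer.
  rewrite <- (odd_sum_linear (fun m => delay_weight a b (S k) (S m)));
    try apply geom_bounded_delay_weight.
  - apply is_derive_even_sum, geom_bounded_delay_weight.
  - apply delay_weight_pascal.
Qed.

Lemma S_layer_at_0 (a b : R) (k : nat) : S_layer a b k 0 = 0.
Proof. apply odd_sum_0. Qed.

Lemma C_layer_0_at_0 (a b : R) : C_layer a b 0 0 = 1.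
Proof. unfold C_layer. now rewrite even_sum_0, delay_weight_0. Qed.

Lemma C_layer_S_at_0 (a b : R) (k : nat) : C_layer a b (S k) 0 = 0.
Proof. unfold C_layer. now rewrite even_sum_0. Qed.

Lemma Series_from_delay_weight (a b : R) (k : nat) (v : nat -> R) :
  Series_from k (fun m => Binomial.C m k * a ^ (m - k) * b ^ k * v m)
  = Series (fun m => delay_weight a b k m * v m).
Proof.
  rewrite (Series_incr_n_aux _ k).
  - apply Series_ext. intros j. unfold delay_weight.
    now destruct (Nat.leb_spec k (k + j)); [ | lia ].
  - intros m hm. unfold delay_weight.
    destruct (Nat.leb_spec k m); [ lia | ring ].
Qed.

Lemma delay_C_layers (a b tau t : R) :
  0 <= t ->
  delay_C a b tau t
  = Series (fun k => C_layer a b k (pos_part (t - INR k * tau))).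
Proof.
  intros ht. unfold delay_C. destruct (Rlt_dec t 0); [ lra | ].
  apply Series_ext. intros k.
  rewrite (Series_from_delay_weight a b k
    (fun m => pos_part (t - INR k * tau) ^ (2 * m) / INR (fact (2 * m)))).
  symmetry. apply even_sum_Series, geom_bounded_delay_weight.
Qed.

Lemma pos_part_nonpos (t : R) : t <= 0 -> pos_part t = 0.
Proof. apply Rmax_left. Qed.

Lemma pos_part_nonneg (t : R) : 0 <= t -> pos_part t = t.
Proof. apply Rmax_right. Qed.

Lemma Series_zero : Series (fun _ => 0) = 0.
Proof.
  rewrite (Series_ext _ (fun _ => 0 * 0)) by (intros; ring).
  rewrite (Series_scal_l 0 (fun _ => 0)). ring.
Qed.

(** For [t < 0] the sum agrees with the extension by zero because every layer of
    [S] vanishes at [0]; [C] has no such identity, since its layer [0] is [1] there. *)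
Lemma delay_S_layers (a b tau t : R) :
  0 <= tau ->
  delay_S a b tau t
  = Series (fun k => S_layer a b k (pos_part (t - INR k * tau))).
Proof.
  intros htau. unfold delay_S. destruct (Rlt_dec t 0).
  - rewrite <- Series_zero at 1. apply Series_ext. intros k.
    rewrite pos_part_nonpos; [ now rewrite S_layer_at_0 | ].
    pose proof (pos_INR k). nra.
  - apply Series_ext. intros k.
    rewrite (Series_from_delay_weight a b k
      (fun m => pos_part (t - INR k * tau) ^ (2 * m + 1)
                / INR (fact (2 * m + 1)))).
    symmetry. apply odd_sum_Series, geom_bounded_delay_weight.
Qed.

Fixpoint psum (u : nat -> R) (n : nat) : R :=
  match n with O => 0 | S n' => psum u n' + u n' end.

Lemma Series_finite_support (u : nat -> R) (n : nat) :
  (forall k, (n <= k)%nat -> u k = 0) -> Series u = psum u n.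
Proof.
  intros hu. apply is_series_unique.
  assert (H : forall j, psum u (n + j) = psum u n).
  { induction j as [ | j IH]; [ now rewrite Nat.add_0_r | ].
    rewrite Nat.add_succ_r. simpl. rewrite IH, hu by lia. ring. }
  assert (Hs : forall j, sum_n u j = psum u (S j)).
  { induction j as [ | j IH].
    - rewrite sum_O. simpl. ring.
    - rewrite sum_Sn, IH. reflexivity. }
  apply (filterlim_ext_loc (fun _ => psum u n)); [ | apply filterlim_const ].
  exists n. intros j hj. rewrite Hs.
  replace (S j) with (n + (S j - n))%nat by lia. now rewrite H.
Qed.

Lemma psum_incr_1 (u : nat -> R) (n : nat) :
  psum u (S n) = u 0%nat + psum (fun k => u (S k)) n.
Proof.
  induction n as [ | n IH]; [ simpl; ring | ].
  change (psum u (S n) + u (S n) = u 0%nat + (psum (fun k => u (S k)) n + u (S n))).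
  rewrite IH. ring.
Qed.

(** If [f'(0) = 0], freezing [f] to the left of [0] creates no corner. *)
Lemma is_derive_pos_part_comp (f df : R -> R) (c t : R) :
  (forall x, is_derive f x (df x)) -> df 0 = 0 ->
  is_derive (fun s => f (pos_part (s - c))) t (df (pos_part (t - c))).
Proof.
  intros hf h0.
  assert (He : is_derive (fun s => f (pos_part s)) (t - c) (df (pos_part (t - c)))).
  { apply (is_derive_ext (extension_C1 f df 0 p_infty)).
    - intros s. unfold extension_C1, pos_part.
      destruct (Rbar_le_dec 0 s) as [hs | hs]; simpl in hs.
      + destruct (Rbar_le_dec s p_infty) as [_ | hi]; [ | now elim hi ].
        now rewrite Rmax_right.
      + simpl real. rewrite h0, Rmax_left by lra. apply Rminus_diag_uniq.
        unfold plus, scal; simpl; unfold mult; simpl. ring.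
    - replace (df (pos_part (t - c))) with (extension_C0 df 0 p_infty (t - c)).
      + apply extension_C1_is_derive; [ easy | auto ].
      + unfold extension_C0, pos_part.
        destruct (Rbar_le_dec 0 _) as [hs | hs]; simpl in hs.
        * destruct (Rbar_le_dec _ p_infty) as [_ | hi]; [ | now elim hi ].
          now rewrite Rmax_right.
        * simpl real. now rewrite Rmax_left by lra. }
  replace (df _) with (scal 1 (df (pos_part (t - c))))
    by (unfold scal; simpl; unfold mult; simpl; ring).
  apply (is_derive_comp (fun s => f (pos_part s)) (fun s => s - c)); [ exact He | ].
  auto_derive; [ easy | ring ].
Qed.

(** Layer [0] is evaluated at [t] itself instead of [t_+].  This changes nothing
    for [t >= 0] and makes the kernel differentiable at [0], where the extension
    of [S] by zero has a corner and that of [C] a jump. *)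
Definition kernel_S (a b tau : R) (K : nat) (t : R) : R :=
  S_layer a b 0 t
  + psum (fun k => S_layer a b (S k) (pos_part (t - INR (S k) * tau))) K.
Definition kernel_C (a b tau : R) (K : nat) (t : R) : R :=
  C_layer a b 0 t
  + psum (fun k => C_layer a b (S k) (pos_part (t - INR (S k) * tau))) K.

Lemma is_derive_psum (f : nat -> R -> R) (df : nat -> R) (t : R) (n : nat) :
  (forall k, is_derive (f k) t (df k)) ->
  is_derive (fun s => psum (fun k => f k s) n) t (psum df n).
Proof.
  intros hf. induction n as [ | n IH]; simpl.
  - apply (is_derive_const 0 t).
  - apply (is_derive_plus (fun s => psum (fun k => f k s) n)); auto.
Qed.

Lemma is_derive_kernel_S (a b tau : R) (K : nat) (t : R) :
  is_derive (kernel_S a b tau K) t (kernel_C a b tau K t).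
Proof.
  apply (is_derive_plus (S_layer a b 0)); [ apply is_derive_S_layer | ].
  apply (is_derive_psum
           (fun k s => S_layer a b (S k) (pos_part (s - INR (S k) * tau)))).
  intros k. apply is_derive_pos_part_comp.
  - apply is_derive_S_layer.
  - apply C_layer_S_at_0.
Qed.

Lemma delay_S_psum (a b tau t : R) (K : nat) :
  0 <= tau -> t <= INR K * tau ->
  delay_S a b tau t
  = psum (fun k => S_layer a b k (pos_part (t - INR k * tau))) K.
Proof.
  intros htau ht. rewrite delay_S_layers by exact htau.
  apply Series_finite_support. intros k hk.
  rewrite pos_part_nonpos; [ apply S_layer_at_0 | ].
  pose proof (le_INR _ _ hk). nra.
Qed.

Lemma psum_linear (u v : nat -> R) (c d : R) (n : nat) :
  psum (fun k => c * u k + d * v k) n = c * psum u n + d * psum v n.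
Proof. induction n as [ | n IH]; simpl; [ ring | rewrite IH; ring ]. Qed.

(** The lower layer left over by Pascal's rule in layer [k + 1] is layer [k] at
    time [t - tau], so these terms add up to [delay_S] at [t - tau].  The bound on
    [t] ensures that [K] layers are enough. *)
Lemma is_derive_kernel_C (a b tau : R) (K : nat) (t : R) :
  0 <= tau -> t - tau <= INR K * tau ->
  is_derive (kernel_C a b tau K) t
    (a * kernel_S a b tau K t + b * delay_S a b tau (t - tau)).
Proof.
  intros htau ht. unfold kernel_S. rewrite (delay_S_psum a b tau (t - tau) K) by easy.
  rewrite Rmult_plus_distr_l, Rplus_assoc, <- psum_linear.
  apply (is_derive_plus (C_layer a b 0)); [ apply is_derive_C_layer_0 | ].
  apply (is_derive_psum
           (fun k s => C_layer a b (S k) (pos_part (s - INR (S k) * tau)))).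
  intros k.
  replace (t - tau - INR k * tau) with (t - INR (S k) * tau)
    by (rewrite S_INR; ring).
  apply (is_derive_pos_part_comp _
           (fun x => a * S_layer a b (S k) x + b * S_layer a b k x)).
  - apply is_derive_C_layer_S.
  - rewrite !S_layer_at_0. ring.
Qed.

Lemma delay_S_kernel (a b tau t : R) (K : nat) :
  0 <= tau -> 0 <= t <= INR K * tau ->
  delay_S a b tau t = kernel_S a b tau K t.
Proof.
  intros htau ht.
  rewrite (delay_S_psum a b tau t (S K)), psum_incr_1; [ | easy | rewrite S_INR; nra ].
  unfold kernel_S. f_equal. f_equal. simpl. rewrite pos_part_nonneg; lra.
Qed.

Lemma delay_C_kernel (a b tau t : R) (K : nat) :
  0 <= tau -> 0 <= t <= INR K * tau ->
  delay_C a b tau t = kernel_C a b tau K t.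
Proof.
  intros htau ht. rewrite delay_C_layers by apply ht.
  rewrite (Series_finite_support _ (S K)), psum_incr_1.
  - unfold kernel_C. f_equal. f_equal. simpl. rewrite pos_part_nonneg; lra.
  - intros [ | k] hk; [ lia | ].
    rewrite pos_part_nonpos; [ apply C_layer_S_at_0 | ].
    pose proof (le_INR _ _ hk) as hle. rewrite !S_INR in *. nra.
Qed.

Lemma kernel_S_at_0 (a b tau : R) (K : nat) :
  0 <= tau -> kernel_S a b tau K 0 = 0.
Proof.
  intros htau. rewrite <- delay_S_kernel by (pose proof (pos_INR K); nra).
  rewrite (delay_S_psum _ _ _ _ 0); simpl; lra.
Qed.

Lemma kernel_C_at_0 (a b tau : R) (K : nat) :
  0 <= tau -> kernel_C a b tau K 0 = 1.
Proof.
  intros htau. rewrite <- delay_C_kernel by (pose proof (pos_INR K); nra).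
  rewrite (delay_C_kernel _ _ _ _ 0) by (simpl; lra).
  unfold kernel_C. rewrite C_layer_0_at_0. simpl. ring.
Qed.

(** * One-sided calculus on compact intervals *)

Lemma is_derive_continuous (f : R -> R) (t l : R) :
  is_derive f t l -> continuous f t.
Proof. intros h. apply (@ex_derive_continuous R_AbsRing). now exists l. Qed.

Lemma Derive_eta (f : R -> R) (t l : R) :
  is_derive f t l -> Derive (fun x : R => f x) t = l.
Proof. apply is_derive_unique. Qed.

Lemma zero_derivative_eq (F : R -> R) (c d : R) :
  c <= d -> (forall t, c <= t <= d -> continuous F t) ->
  (forall t, c < t < d -> is_derive F t 0) -> F d = F c.
Proof.
  intros hcd hcont hder.
  destruct (MVT_gen F c d (fun _ => 0)) as (x & _ & hx).
  - rewrite Rmin_left, Rmax_right by lra. exact hder.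
  - rewrite Rmin_left, Rmax_right by lra. intros x hx.
    now apply continuity_pt_filterlim, hcont.
  - lra.
Qed.

Lemma is_derive_primitive (q : R -> R) (c t : R) :
  (forall s, continuous q s) -> is_derive (fun x => RInt q c x) t (q t).
Proof.
  intros hq. apply is_derive_RInt with c; [ | apply hq ].
  apply filter_forall. intros x. apply (@RInt_correct R_CompleteNormedModule).
  apply (@ex_RInt_continuous R_CompleteNormedModule). auto.
Qed.

Definition clamp (c d t : R) : R := Rmax c (Rmin d t).

Lemma clamp_in (c d t : R) : c <= d -> c <= clamp c d t <= d.
Proof.
  intros h. unfold clamp, Rmax, Rmin.
  destruct (Rle_dec d t), (Rle_dec c _); lra.
Qed.

Lemma clamp_id (c d t : R) : c <= t <= d -> clamp c d t = t.
Proof. intros h. unfold clamp. rewrite Rmin_right, Rmax_right; lra. Qed.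

(** Composition with the 1-Lipschitz retraction onto [[c, d]] turns one-sided
    continuity at the endpoints into continuity on the line. *)
Lemma continuous_clamp_comp (c d : R) (f : R -> R) (t : R) :
  c <= d -> continuous_on (closed_itv c d) f ->
  continuous (fun x => f (clamp c d x)) t.
Proof.
  intros hcd hf P hP.
  destruct (hf _ (clamp_in c d t hcd) P hP) as [eps heps].
  exists eps. intros x hx. apply heps; [ | now apply clamp_in ].
  refine (Rle_lt_trans _ _ _ _ hx).
  change (Rabs (clamp c d x - clamp c d t) <= Rabs (x - t)).
  unfold clamp, Rmax, Rmin.
  destruct (Rle_dec d t), (Rle_dec d x); repeat destruct (Rle_dec c _);
    unfold Rabs; repeat destruct Rcase_abs; lra.
Qed.

Lemma D_in_interior (f df : R -> R) (c d t : R) :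
  c < t < d -> D_in f df (closed_itv c d) t -> is_derive f t (df t).
Proof.
  intros ht hD. apply is_derive_Reals. intros eps heps.
  destruct (hD eps heps) as (del & hdel & H).
  assert (hm : 0 < Rmin del (Rmin (t - c) (d - t))) by (repeat apply Rmin_pos; lra).
  exists (mkposreal _ hm). intros h hh0 hh. simpl in hh.
  pose proof (Rmin_l del (Rmin (t - c) (d - t))).
  pose proof (Rmin_r del (Rmin (t - c) (d - t))).
  pose proof (Rmin_l (t - c) (d - t)). pose proof (Rmin_r (t - c) (d - t)).
  pose proof (Rabs_def2 _ _ hh).
  specialize (H (t + h)). simpl in H. unfold Rdist in H.
  replace (t + h - t) with h in H by ring.
  apply H. split; [ split; [ unfold closed_itv; lra | lra ] | lra ].
Qed.

Lemma is_derive_D_in (f df : R -> R) (D : R -> Prop) (t : R) :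
  is_derive f t (df t) -> D_in f df D t.
Proof.
  intros h eps heps. apply is_derive_Reals in h.
  destruct (h eps heps) as (del & H). exists del. split; [ apply cond_pos | ].
  intros x ((_ & hne) & hx). simpl in *. unfold Rdist in *.
  specialize (H (x - t)). replace (t + (x - t)) with x in H by ring.
  apply H; [ lra | exact hx ].
Qed.

(** The extension is the primitive of [df] composed with the retraction onto
    [[c, d]]; it agrees with [f] there because the difference is continuous with
    zero derivative inside. *)
Lemma C1_on_extension (c d : R) (f df : R -> R) :
  c <= d -> C1_on c d f df ->
  exists g dg : R -> R,
    (forall t, is_derive g t (dg t)) /\ (forall t, continuous dg t) /\
    (forall t, c <= t <= d -> g t = f t /\ dg t = df t).
Proof.
  intros hcd (hf & hD & hdf).
  set (dg := fun t => df (clamp c d t)).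
  assert (hdg : forall t, continuous dg t)
    by (intros t; now apply continuous_clamp_comp).
  assert (hg : forall t, is_derive (fun x => f c + RInt dg c x) t (dg t)).
  { intros t. rewrite <- (Rplus_0_l (dg t)).
    apply (is_derive_plus (fun _ => f c)).
    - apply (is_derive_const (f c)).
    - now apply is_derive_primitive. }
  exists (fun t => f c + RInt dg c t), dg.
  split; [ exact hg | split; [ exact hdg | ] ].
  intros t ht. split; [ | unfold dg; now rewrite clamp_id ].
  assert (H : f (clamp c d t) - (f c + RInt dg c t)
              = f (clamp c d c) - (f c + RInt dg c c)).
  { apply (zero_derivative_eq
      (fun x => f (clamp c d x) - (f c + RInt dg c x))); [ lra | | ].
    - intros x _. apply (continuous_minus (fun x => f (clamp c d x))).
      + now apply continuous_clamp_comp.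
      + eapply is_derive_continuous, hg.
    - intros x hx. rewrite <- (Rminus_diag (dg x)).
      apply (is_derive_minus (fun x => f (clamp c d x))); [ | apply hg ].
      unfold dg at 1. rewrite clamp_id by lra.
      apply (is_derive_ext_loc f).
      + apply (locally_interval _ x c d); [ simpl; lra | simpl; lra | ].
        simpl. intros y hy1 hy2. rewrite clamp_id; [ easy | lra ].
      + apply D_in_interior with c d; [ lra | apply hD; unfold closed_itv; lra ]. }
  rewrite !clamp_id in H by lra. rewrite RInt_point in H.
  unfold zero in H; simpl in H. lra.
Qed.

(** The difference between [f] and the primitive of [q] is continuous, so it cannot
    jump at the breakpoints, where [f] may fail to be differentiable. *)
Lemma piecewise_derivative_integral (f q : R -> R) (tau : R) (N : nat) :
  0 < tau -> (forall t, continuous f t) -> (forall t, continuous q t) ->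
  (forall k : nat, (1 <= k <= N)%nat ->
     forall t, (INR k - 1) * tau < t < INR k * tau -> is_derive f t (q t)) ->
  forall t, 0 <= t <= INR N * tau -> f t = f 0 + RInt q 0 t.
Proof.
  intros htau hf hq. induction N as [ | N IH]; intros hd t ht.
  - simpl in ht. replace t with 0 by lra. rewrite RInt_point.
    unfold zero; simpl. ring.
  - assert (IH' : forall t, 0 <= t <= INR N * tau -> f t = f 0 + RInt q 0 t).
    { apply IH. intros k hk. apply hd. lia. }
    destruct (Rle_dec t (INR N * tau)) as [hle | hgt]; [ apply IH'; lra | ].
    assert (hN : 0 <= INR N * tau) by (pose proof (pos_INR N); nra).
    assert (H : f t - RInt q 0 t = f (INR N * tau) - RInt q 0 (INR N * tau)).
    { apply (zero_derivative_eq (fun x => f x - RInt q 0 x)); [ lra | | ].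
      - intros x _. apply (continuous_minus f); [ apply hf | ].
        eapply is_derive_continuous. now apply is_derive_primitive.
      - intros x hx. rewrite <- (Rminus_diag (q x)).
        apply (is_derive_minus f); [ | now apply is_derive_primitive ].
        apply (hd (S N)); [ lia | ]. rewrite S_INR in *. lra. }
    rewrite (IH' (INR N * tau)) in H by lra. lra.
Qed.

(** * The representation formula by Green's identity *)

Lemma continuous_pos_part (t : R) : continuous pos_part t.
Proof.
  intros P [eps heps]. exists eps. intros x hx. apply heps.
  refine (Rle_lt_trans _ _ _ _ hx).
  change (Rabs (pos_part x - pos_part t) <= Rabs (x - t)).
  unfold pos_part, Rmax.
  destruct (Rle_dec 0 x), (Rle_dec 0 t);
    unfold Rabs; repeat destruct Rcase_abs; lra.
Qed.

(** The right side is continuous in [t] on the whole line, which the case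
    distinction in the definition of [delay_S] hides. *)
Lemma delay_S_kernel_pos_part (a b tau t : R) (K : nat) :
  0 <= tau -> t <= INR K * tau ->
  delay_S a b tau t = kernel_S a b tau K (pos_part t).
Proof.
  intros htau ht. destruct (Rle_dec 0 t).
  - rewrite pos_part_nonneg by easy. now apply delay_S_kernel.
  - rewrite pos_part_nonpos, kernel_S_at_0 by lra.
    unfold delay_S. destruct (Rlt_dec t 0); [ easy | lra ].
Qed.

Definition solves_pieces (a b tau : R) (N : nat) (Y dY : R -> R) : Prop :=
  forall k : nat, (1 <= k <= N)%nat ->
  forall t, (INR k - 1) * tau < t < INR k * tau ->
    is_derive dY t (a * Y t + b * Y (t - tau)).

Lemma continuous_delay_term (b tau : R) (Y : R -> R) (t : R) :
  (forall t, continuous Y t) -> continuous (fun t => b * Y (t - tau)) t.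
Proof.
  intros hY. apply (continuous_mult (fun _ => b)); [ apply continuous_const | ].
  apply (continuous_comp (fun t => t - tau) Y); [ | apply hY ].
  eapply (is_derive_continuous (fun t => t - tau)).
  auto_derive; [ easy | reflexivity ].
Qed.

Lemma continuous_delay_rhs (a b tau : R) (Y : R -> R) (t : R) :
  (forall t, continuous Y t) -> continuous (fun t => a * Y t + b * Y (t - tau)) t.
Proof.
  intros hY. apply (continuous_plus (fun t => a * Y t)).
  - apply (continuous_mult (fun _ => a)); [ apply continuous_const | apply hY ].
  - now apply continuous_delay_term.
Qed.

(** Green's identity for the pair formed by the solution and the kernel run
    backwards from [t]: it computes any solution from its history. *)
Lemma green_representation (a b tau : R) (N : nat) (Y dY : R -> R) (t : R) :
  0 < tau ->
  (forall t, is_derive Y t (dY t)) -> (forall t, continuous dY t) ->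
  solves_pieces a b tau N Y dY ->
  0 <= t <= INR N * tau ->
  Y t = delay_C a b tau t * Y 0 + delay_S a b tau t * dY 0
        + RInt (fun s => delay_S a b tau (t - tau - s) * b * Y s) (- tau) 0.
Proof.
  intros htau hY hdY heq ht.
  assert (cY : forall s, continuous Y s)
    by (intros s; eapply is_derive_continuous, hY).
  set (q := fun s => a * Y s + b * Y (s - tau)).
  assert (cq : forall s, continuous q s)
    by (intros s; now apply continuous_delay_rhs).
  (* [D] equals [dY] on [[0, N tau]] and is differentiable also at the breakpoints. *)
  set (D := fun s => dY 0 + RInt q 0 s).
  assert (hD : forall s, 0 <= s <= INR N * tau -> dY s = D s)
    by (now apply piecewise_derivative_integral).
  assert (dD : forall s, is_derive D s (q s)).
  { intros s. rewrite <- (Rplus_0_l (q s)).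
    apply (is_derive_plus (fun _ => dY 0)).
    - apply (is_derive_const (dY 0)).
    - now apply is_derive_primitive. }
  set (S := kernel_S a b tau N). set (C := kernel_C a b tau N).
  assert (dS : forall x, is_derive S x (C x)) by (intros; apply is_derive_kernel_S).
  assert (dC : forall x, x <= INR N * tau ->
                 is_derive C x (a * S x + b * delay_S a b tau (x - tau))).
  { intros x hx. apply is_derive_kernel_C; lra. }
  (* The integrand of the formula, in a form that is continuous on the line. *)
  set (W := fun u => S (pos_part (t - tau - u)) * b * Y u).
  assert (cW : forall u, continuous W u).
  { intros u. apply (continuous_mult (fun u => S (pos_part (t - tau - u)) * b));
      [ | apply cY ].
    apply (continuous_mult (fun u => S (pos_part (t - tau - u))));
      [ | apply continuous_const ].
    apply (continuous_comp (fun u => pos_part (t - tau - u)) S).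
    - apply (continuous_comp (fun u => t - tau - u) pos_part).
      + eapply (is_derive_continuous (fun u => t - tau - u)).
        auto_derive; [ easy | reflexivity ].
      + apply continuous_pos_part.
    - eapply is_derive_continuous, dS. }
  set (P := fun u => RInt W (- tau) u).
  assert (dP : forall u, is_derive P u (W u))
    by (intros u; now apply is_derive_primitive).
  assert (hWdelay : forall u, - tau <= u ->
                        delay_S a b tau (t - tau - u) * b * Y u = W u).
  { intros u hu. unfold W, S. rewrite <- delay_S_kernel_pos_part by lra. easy. }
  (* [W] vanishes on [[t - tau, t]], where the kernel is taken at [0]. *)
  assert (hPt : P t = P (t - tau)).
  { apply zero_derivative_eq; [ lra | | ].
    - intros u _. eapply is_derive_continuous, dP.
    - intros u hu. replace 0 with (W u); [ apply dP | ].
      unfold W. rewrite pos_part_nonpos by lra. unfold S.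
      rewrite kernel_S_at_0 by lra. ring. }
  (* Green's identity, with the right side absorbed through the primitive [P] of [W]. *)
  assert (hG : S (t - t) * D t + C (t - t) * Y t - (P (t - tau) - P t)
               = S (t - 0) * D 0 + C (t - 0) * Y 0 - (P (0 - tau) - P 0)).
  { assert (dG : forall s, 0 <= s <= t ->
      is_derive (fun s => S (t - s) * D s + C (t - s) * Y s - (P (s - tau) - P s)) s 0).
    { intros s hs.
      assert (dCs : is_derive C (t - s)
                      (a * S (t - s) + b * delay_S a b tau (t - s - tau)))
        by (apply dC; lra).
      auto_derive.
      - repeat split; eexists; eauto.
      - fold (t - s) (s - tau). rewrite (Derive_eta _ _ _ dCs), (Derive_eta _ _ _ (dS _)),
          (Derive_eta _ _ _ (dD _)), (Derive_eta _ _ _ (hY _)),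
          !(Derive_eta _ _ _ (dP _)).
        rewrite hD by lra. rewrite <- (hWdelay s) by lra.
        unfold W, q. rewrite pos_part_nonneg by lra.
        replace (t - tau - (s - tau)) with (t - s) by ring.
        replace (t - tau - s) with (t - s - tau) by ring. ring. }
    apply (zero_derivative_eq
      (fun s => S (t - s) * D s + C (t - s) * Y s - (P (s - tau) - P s))).
    - lra.
    - intros s hs. eapply is_derive_continuous. now apply dG.
    - intros s hs. apply dG. lra. }
  rewrite (RInt_ext (fun s => delay_S a b tau (t - tau - s) * b * Y s) W).
  2: { intros s hs. rewrite Rmin_left, Rmax_right in hs by lra. apply hWdelay. lra. }
  change (RInt W (- tau) 0) with (P 0).
  rewrite Rminus_diag, Rminus_0_r, Rminus_0_l, hPt in hG.
  replace (P (- tau)) with 0 in hG by (symmetry; apply (RInt_point (- tau) W)).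
  replace (D 0) with (dY 0) in hG
    by (unfold D; rewrite RInt_point; unfold zero; simpl; ring).
  unfold S, C in hG.
  rewrite kernel_S_at_0, kernel_C_at_0 in hG by lra.
  rewrite (delay_S_kernel a b tau t N), (delay_C_kernel a b tau t N) by lra.
  lra.
Qed.

Lemma stepwise_solution_formula (a b tau : R) (N : nat) (phi dphi y : R -> R) (t : R) :
  0 < tau ->
  stepwise_solution a b tau N (fun _ => 0) phi dphi y ->
  0 <= t <= INR N * tau ->
  y t = delay_C a b tau t * phi 0 + delay_S a b tau t * dphi 0
        + RInt (fun s => delay_S a b tau (t - tau - s) * b * phi s) (- tau) 0.
Proof.
  intros htau (dy & ddy & hC1 & hpieces & hhist) ht.
  assert (hN : 0 <= INR N * tau) by lra.
  destruct (C1_on_extension (- tau) (INR N * tau) y dy) as (Y & dY & hY & hdY & hext);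
    [ lra | exact hC1 | ].
  assert (heq : solves_pieces a b tau N Y dY).
  { intros k hk s hs.
    destruct (hpieces k hk) as (hder & _ & _ & hode). unfold open_itv in *.
    assert (INR k <= INR N) by (apply le_INR; lia).
    assert (1 <= INR k) by (change 1 with (INR 1); apply le_INR; lia).
    assert (hk0 : 0 <= (INR k - 1) * tau) by nra.
    assert (hkN : INR k * tau <= INR N * tau) by nra.
    replace (a * Y s + b * Y (s - tau)) with (ddy s).
    - apply (is_derive_ext_loc dy); [ | now apply hder ].
      apply (locally_interval _ s ((INR k - 1) * tau) (INR k * tau));
        [ apply hs | apply hs | ].
      simpl. intros x hx1 hx2. symmetry. apply hext. lra.
    - rewrite (hode s hs). destruct (hext s) as [-> _]; [ lra | ].
      destruct (hext (s - tau)) as [-> _]; [ lra | ring ]. }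
  assert (hhist' : forall s, - tau <= s <= 0 -> Y s = phi s /\ dY s = dphi s).
  { intros s hs. destruct (hext s) as [-> ->]; [ lra | now apply hhist ]. }
  destruct (hext t) as [<- _]; [ lra | ].
  rewrite (green_representation a b tau N Y dY t) by easy.
  destruct (hhist' 0) as [-> ->]; [ lra | ]. f_equal.
  apply RInt_ext. intros s hs. rewrite Rmin_left, Rmax_right in hs by lra.
  destruct (hhist' s) as [-> _]; [ lra | easy ].
Qed.

(** * Existence by the method of steps *)

Lemma extension_cont_left (f g : R -> R) (p t : R) :
  t <= p -> extension_cont f g p t = f t.
Proof. intros h. unfold extension_cont. now destruct (Rle_dec t p). Qed.

Lemma extension_cont_right (f g : R -> R) (p t : R) :
  p < t -> extension_cont f g p t = g t.
Proof. intros h. unfold extension_cont. destruct (Rle_dec t p); [ lra | easy ]. Qed.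

Lemma locally_left (p t : R) (f g : R -> R) :
  t < p -> locally t (fun x => f x = extension_cont f g p x).
Proof.
  intros h. apply (locally_interval _ t m_infty p); [ easy | exact h | ].
  intros x _ hx. simpl in hx. rewrite extension_cont_left; [ easy | lra ].
Qed.

Lemma locally_right (p t : R) (f g : R -> R) :
  p < t -> locally t (fun x => g x = extension_cont f g p x).
Proof.
  intros h. apply (locally_interval _ t p p_infty); [ exact h | easy | ].
  intros x hx _. simpl in hx. now rewrite extension_cont_right.
Qed.

Lemma continuous_glue (f g : R -> R) (p : R) :
  (forall t, continuous f t) -> (forall t, continuous g t) -> f p = g p ->
  forall t, continuous (extension_cont f g p) t.
Proof.
  intros hf hg hp t. destruct (Rtotal_order t p) as [h | [-> | h]].
  - eapply continuous_ext_loc; [ | apply hf ].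
    eapply filter_imp; [ | apply (locally_left p t f g h) ]. easy.
  - now apply extension_cont_continuous.
  - eapply continuous_ext_loc; [ | apply hg ].
    eapply filter_imp; [ | apply (locally_right p t f g h) ]. easy.
Qed.

Lemma is_derive_glue (f df g dg : R -> R) (p : R) :
  (forall t, is_derive f t (df t)) -> (forall t, is_derive g t (dg t)) ->
  f p = g p -> df p = dg p ->
  forall t, is_derive (extension_cont f g p) t (extension_cont df dg p t).
Proof.
  intros hf hg hp hdp t. destruct (Rtotal_order t p) as [h | [-> | h]].
  - rewrite extension_cont_left by lra.
    eapply is_derive_ext_loc; [ apply (locally_left p t f g h) | apply hf ].
  - rewrite extension_cont_left by lra.
    apply extension_cont_is_derive; [ apply hf | rewrite hdp; apply hg | exact hp ].
  - rewrite extension_cont_right by lra.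
    eapply is_derive_ext_loc; [ apply (locally_right p t f g h) | apply hg ].
Qed.

(** The Wronskian of the fundamental pair of [z'' = a z], which are the layers
    [0]; these do not depend on [b], set to [0] here. *)
Lemma wronskian (a x : R) :
  C_layer a 0 0 x * C_layer a 0 0 x - a * (S_layer a 0 0 x * S_layer a 0 0 x) = 1.
Proof.
  set (c := C_layer a 0 0). set (s := S_layer a 0 0).
  assert (dc : forall x, is_derive c x (a * s x)) by (intros; apply is_derive_C_layer_0).
  assert (ds : forall x, is_derive s x (c x)) by (intros; apply is_derive_S_layer).
  assert (dw : forall x, is_derive (fun x => c x * c x - a * (s x * s x)) x 0).
  { intros u. auto_derive.
    - repeat split; eexists; eauto.
    - rewrite (Derive_eta _ _ _ (dc _)), (Derive_eta _ _ _ (ds _)). ring. }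
  assert (h0 : c 0 * c 0 - a * (s 0 * s 0) = 1).
  { unfold c, s. rewrite C_layer_0_at_0, S_layer_at_0. ring. }
  rewrite <- h0.
  assert (H : forall u v, u <= v ->
     c v * c v - a * (s v * s v) = c u * c u - a * (s u * s u)).
  { intros u v huv. apply (zero_derivative_eq (fun x => c x * c x - a * (s x * s x)));
      [ exact huv | | auto ].
    intros w _. eapply is_derive_continuous, dw. }
  destruct (Rle_dec 0 x); [ now apply H | symmetry; apply H; lra ].
Qed.

(** Variation of constants with [c'' = a c], [s'' = a s]: the particular solution
    is [s A - c B], with [A] and [B] primitives of [c h] and [s h]. *)
Lemma forced_oscillator (a p y0 y1 : R) (h : R -> R) :
  (forall t, continuous h t) ->
  exists z dz : R -> R,
    (forall t, is_derive z t (dz t)) /\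
    (forall t, is_derive dz t (a * z t + h t)) /\ z p = y0 /\ dz p = y1.
Proof.
  intros hh.
  set (c := fun t => C_layer a 0 0 (t - p)). set (s := fun t => S_layer a 0 0 (t - p)).
  assert (dc : forall t, is_derive c t (a * s t)).
  { intros t. unfold c, s.
    pose proof (is_derive_C_layer_0 a 0 (t - p)) as H.
    auto_derive; [ repeat split; now eexists; eauto | ].
    fold (t - p). rewrite (Derive_eta _ _ _ H). ring. }
  assert (ds : forall t, is_derive s t (c t)).
  { intros t. unfold c, s.
    pose proof (is_derive_S_layer a 0 0 (t - p)) as H.
    auto_derive; [ repeat split; now eexists; eauto | ].
    fold (t - p). rewrite (Derive_eta _ _ _ H). ring. }
  assert (hw : forall t, c t * c t - a * (s t * s t) = 1) by (intros; apply wronskian).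
  assert (hc0 : c p = 1) by (unfold c; rewrite Rminus_diag; apply C_layer_0_at_0).
  assert (hs0 : s p = 0) by (unfold s; rewrite Rminus_diag; apply S_layer_at_0).
  clearbody c s.
  assert (cch : forall t, continuous (fun u => c u * h u) t).
  { intros t. apply (continuous_mult c); [ eapply is_derive_continuous, dc | apply hh ]. }
  assert (csh : forall t, continuous (fun u => s u * h u) t).
  { intros t. apply (continuous_mult s); [ eapply is_derive_continuous, ds | apply hh ]. }
  set (A := fun t => RInt (fun u => c u * h u) p t).
  set (B := fun t => RInt (fun u => s u * h u) p t).
  assert (dA : forall t, is_derive A t (c t * h t))
    by (intros t; now apply (is_derive_primitive (fun u => c u * h u))).
  assert (dB : forall t, is_derive B t (s t * h t))
    by (intros t; now apply (is_derive_primitive (fun u => s u * h u))).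
  assert (hA0 : A p = 0) by (apply (RInt_point p (fun u => c u * h u))).
  assert (hB0 : B p = 0) by (apply (RInt_point p (fun u => s u * h u))).
  clearbody A B.
  exists (fun t => c t * (y0 - B t) + s t * (y1 + A t)),
         (fun t => a * s t * (y0 - B t) + c t * (y1 + A t)).
  split; [ | split; [ | split ] ].
  - intros t. auto_derive; [ repeat split; eexists; eauto | ].
    rewrite (Derive_eta _ _ _ (dc _)), (Derive_eta _ _ _ (ds _)),
      (Derive_eta _ _ _ (dA _)), (Derive_eta _ _ _ (dB _)). ring.
  - intros t. auto_derive; [ repeat split; eexists; eauto | ].
    rewrite (Derive_eta _ _ _ (dc _)), (Derive_eta _ _ _ (ds _)),
      (Derive_eta _ _ _ (dA _)), (Derive_eta _ _ _ (dB _)).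
    (* The first two occurrences of [h t] come from the derivatives of [A] and [B],
       the third from the equation; multiplying the third by the Wronskian makes
       the two sides equal as polynomials. *)
    replace (h t) with ((c t * c t - a * (s t * s t)) * h t) at 3
      by (rewrite hw; ring).
    ring.
  - rewrite hc0, hs0, hA0, hB0. ring.
  - rewrite hc0, hs0, hA0, hB0. ring.
Qed.

(** Beyond [p = N tau] the solution found so far is replaced by the solution of
    [z'' = a z + b Y (t - tau)] with the same value and slope at [p].  The delayed
    argument stays at or before [p] during the next step, so the forcing is already
    the final one. *)
Lemma method_of_steps (a b tau : R) (f df : R -> R) (N : nat) :
  0 < tau -> (forall t, is_derive f t (df t)) -> (forall t, continuous df t) ->
  exists Y dY : R -> R,
    (forall t, is_derive Y t (dY t)) /\ (forall t, continuous dY t) /\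
    solves_pieces a b tau N Y dY /\
    (forall t, t <= 0 -> Y t = f t /\ dY t = df t).
Proof.
  intros htau hf hdf. induction N as [ | N IH].
  - exists f, df. split; [ easy | split; [ easy | split; [ | easy ] ] ].
    intros k hk. lia.
  - destruct IH as (Y & dY & hY & hdY & heq & hhist).
    set (p := INR N * tau).
    assert (hp : 0 <= p) by (pose proof (pos_INR N); unfold p; nra).
    destruct (forced_oscillator a p (Y p) (dY p) (fun t => b * Y (t - tau)))
      as (z & dz & hz & hdz & hzp & hdzp).
    { intros t. apply continuous_delay_term.
      intros u. eapply is_derive_continuous, hY. }
    exists (extension_cont Y z p), (extension_cont dY dz p).
    split; [ now apply is_derive_glue | ].
    split; [ apply continuous_glue; auto; intros u; eapply is_derive_continuous, hdz | ].
    split.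
    + intros k hk t ht.
      assert (hkN : (k <= N)%nat \/ k = S N) by lia.
      destruct hkN as [hkN | ->].
      * assert (htp : t < p).
        { pose proof (le_INR _ _ hkN). unfold p. nra. }
        rewrite !extension_cont_left by lra.
        eapply is_derive_ext_loc; [ now apply locally_left | ].
        apply (heq k); [ lia | easy ].
      * rewrite S_INR in ht.
        assert (htp : p < t <= p + tau) by (unfold p; lra).
        rewrite extension_cont_right, extension_cont_left by lra.
        eapply is_derive_ext_loc; [ now apply locally_right | apply hdz ].
    + intros t ht. rewrite !extension_cont_left by lra. now apply hhist.
Qed.

Lemma stepwise_solution_exists (a b tau : R) (N : nat) (phi dphi : R -> R) :
  0 < tau -> C1_on (- tau) 0 phi dphi ->
  exists y, stepwise_solution a b tau N (fun _ => 0) phi dphi y.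
Proof.
  intros htau hphi.
  destruct (C1_on_extension (- tau) 0 phi dphi) as (f & df & hf & hdf & hext);
    [ lra | exact hphi | ].
  destruct (method_of_steps a b tau f df N htau hf hdf)
    as (Y & dY & hY & hdY & heq & hhist).
  assert (cY : forall t, continuous Y t)
    by (intros t; eapply is_derive_continuous, hY).
  exists Y, dY, (fun t => a * Y t + b * Y (t - tau)).
  assert (cq : forall t, continuous (fun t => a * Y t + b * Y (t - tau)) t)
    by (intros t; now apply continuous_delay_rhs).
  split; [ | split ].
  - split; [ | split ].
    + apply continuous_on_forall; auto.
    + intros t _. now apply is_derive_D_in.
    + apply continuous_on_forall; auto.
  - intros k hk I J. split; [ | split; [ | split ] ].
    + now apply heq.
    + apply continuous_on_forall; auto.
    + exists (fun t => a * Y t + b * Y (t - tau)). split; [ | easy ].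
      apply continuous_on_forall; auto.
    + intros t _. ring.
  - intros t ht. destruct (hhist t) as [-> ->]; [ lra | now apply hext ].
Qed.

Theorem theorem2 (a b tau T : R) (N : nat) (phi dphi : R -> R)
    (htau : 0 < tau) (hN : (1 <= N)%nat) (hT : T = INR N * tau)
    (hphi : C1_on (- tau) 0 phi dphi) :
  (exists y : R -> R,
     stepwise_solution a b tau N (fun _ => 0) phi dphi y) /\
  (forall y : R -> R,
     stepwise_solution a b tau N (fun _ => 0) phi dphi y ->
     forall t : R, 0 <= t <= T ->
       y t = delay_C a b tau t * phi 0 + delay_S a b tau t * dphi 0
             + RInt (fun s => delay_S a b tau (t - tau - s) * b * phi s)
                    (- tau) 0).
Proof.
  split.
  - now apply stepwise_solution_exists.
  - intros y hy t ht. apply (stepwise_solution_formula a b tau N phi dphi y);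
      [ easy | easy | ].
    now rewrite <- hT.
Qed.
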